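(* Let $\Phi$ be the property of being orderable. Then for all integers $n\ge3$, $$\tau_\Phi(n,0)=n-2.$$ Further, up to isomorphism, the nonlinear orderable betweenness structures of minimum co-size (that is, those orderable betweenness structures of order $n\geq 3$ whose co-size equals $\tau_\Phi(n,0)$) are the following: - $\mathcal{Q}_n^2$ for $n\ge3$; - $\mathcal{R}_{n,i}^2$ for $n\ge4$, $i\in I_n^2$; - $\mathcal{S}_n^2$ for $n\ge3$.
   Context: A betweenness structure is a pair $\mathcal{B}=(X,\beta)$ where $X$ is a nonempty finite set and $\beta\subseteq X^3$; write $(x\ y\ z)$ for $(x,y,z)\in\beta$. All betweenness structures are assumed to be almost-metrizable, i.e. for all $x,y,z,w\in X$: (P1) $(x\ x\ z)$; (P2) $(x\ y\ z)\Rightarrow(z\ y\ x)$; (P3) $(x\ y\ z)\wedge(y\ x\ z)\Rightarrow x=y$; (P4) $(x\ y\ z)\wedge(x\ w\ y)\Rightarrow(x\ w\ z)\wedge(w\ y\ z)$. The order of $\mathcal{B}$ is $|X|$. A set of three distinct points is collinear if some ordering of it is in $\beta$; otherwise it is a triangle. The co-size of $\mathcal{B}$ is its number of triangles; $\mathcal{B}$ is linear if its co-size is $0$, and nonlinear otherwise. Isomorphisms are bijections of ground sets preserving betweenness in both directions. Graphs are connected with positive real edge weights (weight $1$ unless specified). For a graph $W$ with shortest-path metric $d_W$ (path length is the sum of edge weights), the betweenness structure $\mathcal{B}(W)$ induced by $W$ lives on the vertex set and has $(x\ y\ z)$ iff $d_W(x,z)=d_W(x,y)+d_W(y,z)$.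 A betweenness structure is ordered if it is induced by a path. A structure $(X,\beta_1)$ is an extension of $(X,\beta_2)$ (same ground set) if $\beta_1\supseteq\beta_2$. A betweenness structure is orderable if it has an ordered extension. For a hereditary property $\Phi$ of betweenness structures, $B_\Phi(n,m)$ is the set of betweenness structures of order $n$ and co-size $m$ that satisfy $\Phi$, and $\tau_\Phi(n,k)=\min\{m>k:B_\Phi(n,m)\ne\emptyset\}$. Let $I_n^2=\{i\in\mathbb{N}:1\le i\le\lceil\frac{n-3}{2}\rceil\}$. The following graphs have vertex set $\{x_1,\dots,x_{n-2},y,z\}$ and are obtained from the path $P=x_1x_2\ldots x_{n-2}$: - $Q_n^2$ ($n\ge3$): add edges $\{y,x_1\},\{z,x_1\}$ and $\{y,z\}$; - $R_{n,i}^2$ ($n\ge4$, $i\in I_n^2$): delete edge $\{x_i,x_{i+1}\}$, and add edges $\{y,x_i\},\{z,x_i\},\{y,x_{i+1}\},\{z,x_{i+1}\}$ and $\{y,z\}$; - $S_n^2$ ($n\ge3$): add edges $\{x_1,y\},\{x_{n-2},z\}$, and add edge $\{y,z\}$ of weight $n-2$. $\mathcal{Q}_n^2,\mathcal{R}_{n,i}^2,\mathcal{S}_n^2$ are the betweenness structures induced by $Q_n^2,R_{n,i}^2,S_n^2$. *)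

(* Defs.v *)
From mathcomp Require Import all_boot all_order all_algebra.
From mathcomp Require Import boolp classical_sets reals.
Set Implicit Arguments.
Unset Strict Implicit.
Unset Printing Implicit Defensive.
Import Order.TTheory GRing.Theory Num.Theory.
Local Open Scope ring_scope.

Section Betweenness.
Variable X : finType.
Implicit Types B : {set X * X * X}.

Definition almost_metrizable B : Prop :=
  [/\ forall x z, (x, x, z) \in B,
      forall x y z, (x, y, z) \in B -> (z, y, x) \in B,
      forall x y z, (x, y, z) \in B -> (y, x, z) \in B -> x = y
    & forall x y z w, (x, y, z) \in B -> (x, w, y) \in B ->
        (x, w, z) \in B /\ (w, y, z) \in B].

Definition betweenness_structure B : Prop :=
  (0 < #|X|)%N /\ almost_metrizable B.

Definition collinear B (T : {set X}) : bool :=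
  [exists x in T, exists y in T, exists z in T,
     uniq [:: x; y; z] && ((x, y, z) \in B)].

Definition triangles B : {set {set X}} :=
  [set T : {set X} | (#|T| == 3)%N && ~~ collinear B T].

Definition cosize B : nat := #|triangles B|.

End Betweenness.

Definition isomorphic (X Y : finType)
    (B : {set X * X * X}) (C : {set Y * Y * Y}) : Prop :=
  exists2 f : X -> Y, bijective f &
    forall x y z, ((x, y, z) \in B) = ((f x, f y, f z) \in C).

(* An edge is an unordered pair, i.e. a two-element set of vertices; only the
   weights of members of [edges] matter. *)
Record wgraph (R : realType) (V : finType) := WGraph {
  edges : {set {set V}};
  weight : {set V} -> R }.

Section Distance.
Variables (R : realType) (V : finType) (W : wgraph R V).

Definition adj : rel V := fun u v => [set u; v]%SET \in edges W.

(* The path [x :: p]; [zip (x :: p) p] lists its consecutive vertices. *)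
Definition path_length (x : V) (p : seq V) : R :=
  \sum_(e <- zip (x :: p) p) weight W [set e.1; e.2]%SET.

(* For a connected graph this infimum is a minimum over a finite nonempty
   set. *)
Definition dist (x y : V) : R :=
  inf [set path_length x p | p in
         [set p : seq V | [/\ path adj x p, uniq (x :: p) & last x p = y]]].

Definition induced : {set V * V * V} :=
  [set t : V * V * V |
     dist t.1.1 t.2 == dist t.1.1 t.1.2 + dist t.1.2 t.2]%SET.

End Distance.

Definition path_edges (V : finType) (s : seq V) : {set {set V}} :=
  [set [set e.1; e.2] | e in zip s (behead s)]%SET.

(* [s] lists the vertices in the order in which the path visits them. *)
Definition ordered (R : realType) (X : finType) (B : {set X * X * X}) : Prop :=
  exists s : seq X, [/\ uniq s, forall x, x \in s
    & B = induced (WGraph (path_edges s) (fun=> 1 : R))].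

Definition orderable (R : realType) (X : finType) (B : {set X * X * X}) : Prop :=
  exists2 C : {set X * X * X}, ordered R C & B \subset C.

Definition bproperty := forall X : finType, {set X * X * X} -> Prop.

Definition in_B (Phi : bproperty) (n m : nat) (X : finType)
    (B : {set X * X * X}) : Prop :=
  [/\ betweenness_structure B, #|X| = n, cosize B = m & Phi X B].

Definition B_nonempty (Phi : bproperty) (n m : nat) : Prop :=
  exists (X : finType) (B : {set X * X * X}), in_B Phi n m B.

(* [ex_minn] is the least element; the value 0, which is never > k, stands for
   the minimum of the empty set. *)
Definition tau (Phi : bproperty) (n k : nat) : nat :=
  match pselect (exists m : nat, (k < m)%N && `[< B_nonempty Phi n m >]) with
  | left h => ex_minn h
  | right _ => 0
  end.

Section Graphs.
Variables (R : realType) (n : nat).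

(* The n vertices x_1, ..., x_(n-2), y, z for n >= 3. *)
Definition vertex : finType := ('I_(n - 3).+1 + bool)%type.
(* [vx j] is x_j; only meaningful for 1 <= j <= n - 2. *)
Definition vx (j : nat) : vertex := inl (inord j.-1).
Definition vy : vertex := inr false.
Definition vz : vertex := inr true.

Definition P_edges : {set {set vertex}} :=
  path_edges [seq vx j | j <- iota 1 (n - 2)].

Definition Q2 : wgraph R vertex :=
  WGraph (P_edges :|: [set [set vy; vx 1]; [set vz; vx 1]; [set vy; vz]])%SET
    (fun=> 1).

Definition R2 (i : nat) : wgraph R vertex :=
  WGraph
    ((P_edges :\ [set vx i; vx i.+1]) :|:
       [set [set vy; vx i]; [set vz; vx i]; [set vy; vx i.+1];
            [set vz; vx i.+1]; [set vy; vz]])%SET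
    (fun=> 1).

Definition S2 : wgraph R vertex :=
  WGraph
    (P_edges :|: [set [set vx 1; vy]; [set vx (n - 2); vz]; [set vy; vz]])%SET
    (fun e => if e == [set vy; vz]%SET then (n - 2)%:R else 1).

(* [uphalf m] is the ceiling of m / 2. *)
Definition I2 (i : nat) : bool := (1 <= i <= uphalf (n - 3))%N.

End Graphs.

(* Main.v *)
(* An orderable structure can be read on the positions of an ordering: it
   consists of some of the triples i < j < k.  On four points a < b < c < d,
   (P4) says that abc and acd are both collinear iff abd and bcd are, so each
   triangle t and point v outside t give another triangle through v inside
   t + v.  These are distinct for distinct v, whence at least n - 2 triangles.
   In case of equality any two triangles share two points, which forces all of
   them to contain a common pair p, q, and every triple containing this pair is
   a triangle.  The four-point condition then excludes having both a point
   between p and q and a point outside, so p and q are consecutive (Q and R) or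
   the two ends of the ordering (S). *)
Require Import Defs.
From mathcomp Require Import all_boot all_order all_algebra.
From mathcomp Require Import boolp classical_sets reals.
From mathcomp Require Import fintype finset zify.
Set Implicit Arguments.
Unset Strict Implicit.
Unset Printing Implicit Defensive.
Import Order.TTheory GRing.Theory Num.Theory.

(** * Computing distances and edges of the given graphs *)

(** [d] is certified as the distance without enumerating paths: the edge inequality bounds every
    path from below, and stepping to a vertex nearer to [y] builds a path attaining the bound. *)
Lemma dist_nat (R : realType) (V : finType) (W : wgraph R V)
    (d : V -> V -> nat) :
    (forall x, d x x = 0) ->
    (forall x u v, adj W u v ->
       (d x v)%:R <= (d x u)%:R + weight W [set u; v])%R ->
    (forall x y, x != y -> exists v, [/\ adj W x v, d v y < d x y
       & (d x y)%:R%R = (weight W [set x; v] + (d v y)%:R)%R]) ->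
  forall x y, dist W x y = (d x y)%:R%R.
Proof.
move=> d0 d_adj d_step x y.
have lower p u : path (adj W) u p ->
    ((d x (last u p))%:R <= (d x u)%:R + path_length W u p)%R.
  rewrite /path_length; elim: p u => [|v p IHp] u /= => [_|/andP[uv vp]].
    by rewrite big_nil addr0.
  rewrite big_cons addrA; apply: (le_trans (IHp v vp)).
  by rewrite lerD2r; exact: d_adj.
have [p [xp Up lp sp]] : exists p, [/\ path (adj W) x p, uniq (x :: p),
    last x p = y & path_length W x p = (d x y)%:R%R].
  have [k] := ubnP (d x y); elim: k x {lower} => // k IHk x; rewrite ltnS => dk.
  (* The added conclusion, that all later vertices are strictly nearer to [y] than [x], keeps the
     constructed path simple. *)
  suff [p [? ? ? ? _]] : exists p, [/\ path (adj W) x p, uniq (x :: p),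
      last x p = y, path_length W x p = (d x y)%:R%R
      & forall v, v \in p -> d v y < d x y] by exists p.
  elim: k x dk {IHk} => [|k IHk] x dk; case: (eqVneq x y) => [->|xy].
  - by exists [::]; rewrite /path_length big_nil d0.
  - by have [v [_ ]] := d_step _ _ xy; move: dk; lia.
  - by exists [::]; rewrite /path_length big_nil d0.
  have [v [xv vy sv]] := d_step _ _ xy.
  have [|p [vp Up lp sp lt_p]] := IHk v; first lia.
  have lt_vp w : w \in v :: p -> d w y < d x y.
    by rewrite inE => /predU1P[->//|/lt_p /ltn_trans]; apply.
  exists (v :: p); split=> //=.
  - by rewrite xv.
  - by rewrite -/(uniq (v :: p)) Up andbT; apply/negP => /lt_vp; rewrite ltnn.
  - by rewrite /path_length big_cons -/(path_length W v p) /= sp sv.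
apply/eqP; rewrite eq_le; apply/andP; split.
  apply: ge_inf; last by exists p.
  by exists (d x y)%:R%R => _ [q [xq _ <-] <-]; have := lower q x xq;
    rewrite d0 add0r.
apply: lb_le_inf; first by exists (path_length W x p); exists p.
by move=> _ [q [xq _ <-] <-]; have := lower q x xq; rewrite d0 add0r.
Qed.

Lemma eq_set2 (T : finType) (a b u v : T) :
  ([set u; v] == [set a; b]) = (u == a) && (v == b) || (u == b) && (v == a).
Proof.
apply/eqP/idP => [E|/orP[]/andP[/eqP-> /eqP->]//]; last by rewrite setUC.
have: u \in [set a; b] by rewrite -E set21.
have: v \in [set a; b] by rewrite -E set22.
have: a \in [set u; v] by rewrite E set21.
have: b \in [set u; v] by rewrite E set22.
rewrite !inE.
by do 4 (case/orP => /eqP ?); subst; rewrite !eqxx ?orbT.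
Qed.

Lemma path_edgesE (T : finType) (s : seq T) (u v : T) : uniq s ->
  ([set u; v] \in path_edges s) = [&& u \in s, v \in s &
    (index v s == (index u s).+1) || (index u s == (index v s).+1)].
Proof.
move=> Us; pose e k := (nth u s k, nth u s k.+1).
have zipE: zip s (behead s) = [seq e k | k <- iota 0 (size s).-1].
  apply: (@eq_from_nth _ (u, u)) => [|k].
    by rewrite size_map size_zip size_iota size_behead; lia.
  rewrite size_zip size_behead => lt_k.
  rewrite nth_zip_cond size_zip size_behead lt_k nth_behead.
  by rewrite (nth_map 0) ?size_iota ?nth_iota //; lia.
apply/imsetP/and3P => [[z /= zs /eqP uvz]|[us vs uv]].
  move: zs; rewrite zipE => /mapP[k]; rewrite mem_iota => lt_k zk.
  have k1 : k < size s by lia.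
  have k2 : k.+1 < size s by lia.
  move: uvz; rewrite {z}zk eq_set2 /= => /orP[]/andP[/eqP uk /eqP vk].
    have iu : index u s = k by rewrite uk index_uniq.
    have iv : index v s = k.+1 by rewrite vk index_uniq.
    by rewrite -!index_mem iu iv eqxx.
  have iu : index u s = k.+1 by rewrite uk index_uniq.
  have iv : index v s = k by rewrite vk index_uniq.
  by rewrite -!index_mem iu iv eqxx orbT.
have sz : index u s < size s /\ index v s < size s by rewrite !index_mem.
case/orP: uv => /eqP uv.
  exists (e (index u s)); last by rewrite /= -uv !nth_index.
  by rewrite zipE map_f // mem_iota; lia.
exists (e (index v s)); last by rewrite /= -uv !nth_index // setUC.
by rewrite zipE map_f // mem_iota; lia.
Qed.

Lemma P_edgesE n (u v : vertex n) : 3 <= n -> ([set u; v] \in P_edges n) =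
  match u, v with
  | inl i, inl j => (j == i.+1 :> nat) || (i == j.+1 :> nat)
  | _, _ => false
  end.
Proof.
move=> n3; have inl_inj : injective (@inl 'I_(n - 3).+1 bool) by move=> ? ? [].
rewrite /P_edges; set s := map _ _.
(* Since x_j is [inl] of j - 1, the path is the enumeration of the ordinals, and the index of a
   vertex in it is its ordinal. *)
have sE : s = map inl (enum 'I_(n - 3).+1).
  rewrite /s (iotaDl 1 0) -map_comp.
  have -> : n - 2 = (n - 3).+1 by lia.
  rewrite -val_enum_ord -map_comp; apply: eq_map => i /=.
  by rewrite /vx add1n /= inord_val.
have Us : uniq s by rewrite sE map_inj_uniq ?enum_uniq.
have sl i : inl i \in s by rewrite sE mem_map ?mem_enum.
have sr b : (inr b \in s) = false by rewrite sE; apply/negP => /mapP[].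
have si i : index (inl i) s = i by rewrite sE index_map // index_enum_ord.
rewrite path_edgesE //; case: u v => [i|b] [j|c]; rewrite ?sr ?andbF //.
by rewrite !sl !si.
Qed.

(** With integral weights, betweenness becomes an equation between natural numbers, within reach of
    [lia]. *)
Lemma induced_nat (R : realType) (V : finType) (W : wgraph R V)
    (d w : V -> V -> nat) :
    (forall x y, adj W x y -> weight W [set x; y] = (w x y)%:R%R) ->
    (forall x, d x x = 0) ->
    (forall x u v, adj W u v -> d x v <= d x u + w u v) ->
    (forall x y, x != y -> exists v, [/\ adj W x v, d v y < d x y
       & d x y = w x v + d v y]) ->
  induced W = [set t | d t.1.1 t.2 == d t.1.1 t.1.2 + d t.1.2 t.2].
Proof.
move=> wE d0 d_adj d_step.
have dE : forall x y, dist W x y = (d x y)%:R%R.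
  apply: dist_nat => // [x u v uv|x y /d_step[v [xv dv dxy]]].
    by rewrite wE // -natrD ler_nat d_adj.
  by exists v; rewrite wE // -natrD dxy; split=> //; rewrite -dxy.
by apply/setP=> -[[x y] z]; rewrite !inE /= !dE -natrD eqr_nat.
Qed.

(** * Betweenness of positions, and the structures of the path, Q, R and S *)

Definition gap (i j : nat) := (i - j) + (j - i).

Definition between (i j k : nat) := (i <= j <= k) || (k <= j <= i).

Definition line (X : finType) (f : X -> nat) : {set X * X * X} :=
  [set t | between (f t.1.1) (f t.1.2) (f t.2)].

(** Only triples of three distinct positions are removed; the degenerate ones must stay because of
    P1. *)
Definition between_without (a b i j k : nat) :=
  between i j k && ~~ let s := [:: i; j; k] in [&& uniq s, a \in s & b \in s].

(** The common form of all extremal structures: an ordered structure in which exactly the triples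
    through the two points at positions [a] and [b] become triangles. *)
Definition line_without (X : finType) (f : X -> nat) (a b : nat) :
    {set X * X * X} :=
  [set t | between_without a b (f t.1.1) (f t.1.2) (f t.2)].

Lemma gapSl i j : i < j -> gap i j = 1 + gap i.+1 j.
Proof. by rewrite /gap; lia. Qed.

Lemma gap_predl i j : j < i -> gap i j = 1 + gap i.-1 j.
Proof. by rewrite /gap; lia. Qed.

Lemma gap_between i j k : (gap i k == gap i j + gap j k) = between i j k.
Proof. by rewrite /gap /between; lia. Qed.

Lemma induced_path (R : realType) (X : finType) (s : seq X) :
    uniq s -> (forall x, x \in s) ->
  induced (WGraph (path_edges s) (fun=> 1 : R)%R) = line (index^~ s).
Proof.
move=> Us sT; have iP x : index x s < size s by rewrite index_mem.
pose d x y := gap (index x s) (index y s).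
rewrite (@induced_nat _ _ _ d (fun _ _ => 1)) //.
- by apply/setP=> t; rewrite !inE gap_between.
- by move=> x; rewrite /d /gap; lia.
- by move=> x u v; rewrite /adj path_edgesE //= !sT /d /gap /=; lia.
move=> x y xy; rewrite /adj /d.
case: (ltngtP (index x s) (index y s)) => [lt|gt|E]; last first.
- by case/eqP: xy; rewrite -(nth_index x (sT x)) E nth_index.
- have iv : index (nth x s (index x s).-1) s = (index x s).-1.
    by rewrite index_uniq // (leq_ltn_trans (leq_pred _) (iP x)).
  exists (nth x s (index x s).-1);
    rewrite path_edgesE // !sT iv (gap_predl gt) ltnSn.
  by split=> //; rewrite prednK ?eqxx ?orbT // (leq_ltn_trans _ gt).
- have iv : index (nth x s (index x s).+1) s = (index x s).+1.
    by rewrite index_uniq // (leq_ltn_trans lt (iP y)).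
  exists (nth x s (index x s).+1);
    rewrite path_edgesE // !sT iv (gapSl lt) ltnSn.
  by rewrite eqxx.
Qed.

(* Positions in the orderings x_1 .. x_i y z x_(i+1) .. x_(n-2), where i = 0 is
   the case of Q, and y x_1 .. x_(n-2) z; inl j is x_(j+1). *)
Definition pos_split n i (v : vertex n) :=
  match v with
  | inl j => if j < i then val j else j.+2
  | inr b => i + b
  end.

(** The ordering y x_1 .. x_(n-2) z, used for S. *)
Definition pos_ends n (v : vertex n) :=
  match v with inl j => j.+1 | inr b => if b then n.-1 else 0 end.

(** Adjacency in Q and R at once: for i = 0 no path edge is deleted, and x_1 alone is joined to y
    and z. *)
Definition adj_split n i (u v : vertex n) :=
  match u, v with
  | inl j, inl k => (k == j.+1 :> nat) && (k != i :> nat)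
                    || (j == k.+1 :> nat) && (j != i :> nat)
  | inr b, inr c => b != c
  | inl j, inr _ | inr _, inl j => (j == i :> nat) || (j.+1 == i)
  end.

(** The vertices y and z are twins. Merging them gives a path on n - 1 places, with [p] as the
    place, and all distances are gaps of places except d(y, z) = 1. Hence only the triples
    containing both y and z are lost. *)
Lemma induced_split (R : realType) n i (E : {set {set vertex n}}) : 3 <= n ->
    i <= n - 3 -> (forall u v, ([set u; v] \in E) = adj_split i u v) ->
  induced (WGraph E (fun=> 1 : R)%R) = line_without (@pos_split n i) i i.+1.
Proof.
move=> n3 le_i adjE.
pose p (v : vertex n) :=
  if v is inl j then (if j < i then val j else j.+1) else i.
pose d (u v : vertex n) :=
  if (u, v) is (inr b, inr c) then nat_of_bool (b != c) else gap (p u) (p v).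
rewrite (@induced_nat _ _ _ d (fun _ _ => 1)) //.
- apply/setP=> -[[x y] z]; rewrite !inE /d /between_without /between /gap /=.
  by case: x y z => [j|[]] [k|[]] [l|[]] /=; rewrite !inE;
    do ?case: (ltnP _ i) => ?; lia.
- by case=> [j|b]; rewrite /d /gap /=; lia.
- move=> x u v; rewrite /adj adjE /d /gap.
  by case: x u v => [j|[]] [k|[]] [l|[]] /=; do ?case: (ltnP _ i) => ?; lia.
move=> x y xy; rewrite /adj.
have inord_n k : k <= n - 3 -> inord k = k :> nat := @inordK (n - 3) k.
case: x y xy => [j|b] [k|c] xy.
- have : j <> k :> nat by move=> /val_inj jk; rewrite jk eqxx in xy.
  have := ltn_ord j; have := ltn_ord k; rewrite !ltnS => k_lt j_lt jk.
  case: (ltnP j k) => [lt|ge].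
    (* The edge from x_i to x_(i+1) is absent, so the walk crosses through y. *)
    have [ji|ji] := eqVneq j.+1 i.
      by exists (inr false); rewrite adjE /d /gap /=; split=> /=;
        do ?case: (ltnP _ i) => ?; lia.
    exists (inl (inord j.+1)); rewrite adjE /d /gap /= inord_n; last by lia.
    by split=> /=; do ?case: (ltnP _ i) => ?; lia.
  have [ji|ji] := eqVneq (j : nat) i.
    by exists (inr false); rewrite adjE /d /gap /=; split=> /=;
      do ?case: (ltnP _ i) => ?; lia.
  exists (inl (inord j.-1)); rewrite adjE /d /gap /= inord_n; last by lia.
  by split=> /=; do ?case: (ltnP _ i) => ?; lia.
- have := ltn_ord j; rewrite ltnS => j_lt.
  have [ji|ji] := boolP ((j == i :> nat) || (j.+1 == i)).
    by exists (inr c); rewrite adjE /d /gap /= ji eqxx; split;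
      move/orP: ji => []/eqP ji=> /=; do ?case: (ltnP _ i) => ?; lia.
  pose j' := if j < i then j.+1 else j.-1.
  exists (inl (inord j')); rewrite adjE /d /gap /= inord_n /j';
    last by case: ifP; lia.
  by case: ifP => ?; split=> /=; do ?case: (ltnP _ i) => ?; lia.
- have := ltn_ord k; rewrite ltnS => k_lt.
  pose j' := if k < i then i.-1 else i.
  exists (inl (inord j')); rewrite adjE /d /gap /= inord_n /j';
    last by case: ifP; lia.
  by case: ifP => ?; split=> /=; do ?case: (ltnP _ i) => ?; lia.
- have bc : b != c by apply: contra xy => /eqP->.
  by exists (inr c); rewrite adjE /d /= bc eqxx.
Qed.

Lemma eq_vertexE n :
  ((forall i j, j.-1 <= n - 3 -> (inl i == vx n j) = (i == j.-1 :> nat)) *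
   (forall b j, (inr b == vx n j) = false)) *
  ((forall i, (inl i == vy n) = false) * (forall b, (inr b == vy n) = ~~ b) *
   (forall i, (inl i == vz n) = false) * (forall b, (inr b == vz n) = b)).
Proof.
do ![split] => //; try by case.
move=> i j le_j; rewrite -[RHS](_ : (i == inord j.-1) = _) //.
by rewrite -val_eqE /= inordK.
Qed.

Lemma induced_Q2 (R : realType) n : 3 <= n ->
  induced (Q2 R n) = line_without (@pos_split n 0) 0 1.
Proof.
move=> n3; apply: induced_split => // u v.
rewrite inE P_edgesE // !inE !eq_set2.
by case: u v => [j|[]] [k|[]]; rewrite !eq_vertexE //=; lia.
Qed.

Lemma induced_R2 (R : realType) n i : 4 <= n -> I2 n i ->
  induced (R2 R n i) = line_without (@pos_split n i) i i.+1.
Proof.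
move=> n4 /andP[i1 iu]; apply: induced_split => [|| u v]; [lia..|].
rewrite inE inE P_edgesE; last lia.
rewrite !inE !eq_set2.
case: u v => [j|[]] [k|[]]; rewrite !eq_vertexE //=; lia.
Qed.

(** The graph is a cycle. The edge yz has weight n - 2, one less than the way from y to z along P,
    so it shortens the distance of y and z and no other. *)
Lemma induced_S2 (R : realType) n : 3 <= n ->
  induced (S2 R n) = line_without (@pos_ends n) 0 n.-1.
Proof.
move=> n3.
pose w (u v : vertex n) := if (u, v) is (inr b, inr c) then n - 2 else 1.
pose d (u v : vertex n) :=
  if (u, v) is (inr b, inr c) then (b != c) * (n - 2)
  else gap (pos_ends u) (pos_ends v).
(* The index [b * (n - 3)] is that of the path vertex next to [inr b]: x_1 for y and x_(n-2) for
   z. *)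
have adjE u v : adj (S2 R n) u v = match u, v with
  | inl i, inl j => (j == i.+1 :> nat) || (i == j.+1 :> nat)
  | inr b, inr c => b != c
  | inl i, inr b | inr b, inl i => i == b * (n - 3) :> nat
  end.
  rewrite /adj inE P_edgesE // !inE !eq_set2.
  by case: u v => [j|[]] [k|[]]; rewrite !eq_vertexE //=; lia.
rewrite (@induced_nat _ _ _ d w) //.
- apply/setP=> -[[x y] z]; rewrite !inE /d /between_without /between /gap /=.
  by case: x y z => [[j ?]|[]] [[k ?]|[]] [[l ?]|[]] /=; rewrite ?inE; lia.
- move=> x y; rewrite adjE /= eq_set2 /w.
  by case: x y => [j|[]] [k|[]].
- by case=> [j|[]]; rewrite /d /gap /=; lia.
- move=> x u v; rewrite adjE /d /w /gap.
  by case: x u v => [[j ?]|[]] [[k ?]|[]] [[l ?]|[]] /=; lia.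
move=> x y xy.
have inord_n k : k <= n - 3 -> inord k = k :> nat := @inordK (n - 3) k.
case: x y xy => [j|b] [k|c] xy.
- have : j <> k :> nat by move=> /val_inj jk; rewrite jk eqxx in xy.
  have := ltn_ord j; have := ltn_ord k; rewrite !ltnS => k_lt j_lt jk.
  pose j' := if j < k then j.+1 else j.-1.
  exists (inl (inord j')); rewrite adjE /d /w /gap /= inord_n /j';
    last by case: ifP; lia.
  by case: ifP => ?; split; lia.
- have := ltn_ord j; rewrite ltnS => j_lt.
  have [ji|ji] := boolP (j == c * (n - 3) :> nat).
    exists (inr c); rewrite adjE /d /w /gap /= ji eqxx.
    by case: c ji {xy} => /=; split; lia.
  pose j' := if c then j.+1 else j.-1.
  exists (inl (inord j')); rewrite adjE /d /w /gap /= inord_n /j';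
    last by case: ifP; lia.
  by case: c ji {xy j'} => /=; split; lia.
- have := ltn_ord k; rewrite ltnS => k_lt.
  exists (inl (inord (b * (n - 3)))); rewrite adjE /d /w /gap /= inord_n;
    last by lia.
  by case: b {xy} => /=; split; lia.
- have bc : b != c by apply: contra xy => /eqP->.
  by exists (inr c); rewrite adjE /d /w /= bc eqxx /= addn0 mul1n; split=> //;
    lia.
Qed.

(** * Families of triples with the exchange property *)

Definition pencil (X : finType) (p q : X) : {set {set X}} :=
  [set T : {set X} | [&& #|T| == 3, p \in T & q \in T]].

(** A member is determined by its third point, which is any point other than p and q. *)
Lemma card_pencil (X : finType) (p q : X) : p != q -> #|pencil p q| = #|X| - 2.
Proof.
move=> pq; pose F u := u |: [set p; q].
have -> : pencil p q = F @: (~: [set p; q]).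
  apply/setP=> T; rewrite !inE; apply/and3P/imsetP => [[T3 pT qT]|[u]].
    have pqT : [set p; q] \subset T by rewrite subUset !sub1set pT.
    have : #|T :\: [set p; q]| == 1 by rewrite cardsDS // cards2 pq (eqP T3).
    case/cards1P => u Tu; have : u \in T :\: [set p; q] by rewrite Tu set11.
    rewrite inE => /andP[upq uT]; exists u; first by rewrite inE.
    by rewrite /F -[LHS](setID T [set p; q]) Tu (setIidPr pqT) setUC.
  rewrite inE => upq ->; split; try by rewrite !inE eqxx ?orbT.
  by rewrite cardsU1 upq cards2 pq.
rewrite card_in_imset; first by rewrite cardsCs setCK cards2 pq.
move=> u v; rewrite !inE => upq _ E.
have : u \in F v by rewrite -E setU11.
by rewrite !inE (negPf upq) orbF => /eqP.
Qed.

Section Exchange.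
Variables (X : finType) (T : {set {set X}}).
Hypothesis T3 : forall t, t \in T -> #|t| = 3.
Hypothesis exchange : forall t v, t \in T -> v \notin t ->
  exists2 t', t' \in T & (v \in t') && (t' \subset v |: t).

(** A choice of the exchanged triple; the default [t] does not occur when [t] is in [T] and [v]
    outside [t]. *)
Let h t v := odflt t [pick t' in T | (v \in t') && (t' \subset v |: t)].

Let hP t v : t \in T -> v \notin t ->
  [/\ h t v \in T, v \in h t v & h t v \subset v |: t].
Proof.
move=> tT vt; rewrite /h; case: pickP => /= [t' /and3P[]//|no].
by have [t' t'T t'P] := exchange tT vt; move: (no t'); rewrite t'T t'P.
Qed.

(** The point u lies in [h t u]; if this is [h t v], it lies in v + t, and u is outside t. *)
Let h_inj t : t \in T -> {in ~: t &, injective (h t)}.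
Proof.
move=> tT u v; rewrite !inE => ut vt E.
have [_ uh _] := hP tT ut; have [_ _ /subsetP hv] := hP tT vt.
by move: (hv u); rewrite -E uh => /(_ isT);
  rewrite !inE (negPf ut) orbF => /eqP.
Qed.

Let h_sub t : t \in T -> h t @: (~: t) \subset T :\ t.
Proof.
move=> tT; apply/subsetP=> _ /imsetP[v /[!inE] vt ->].
have [-> vh _] := hP tT vt; rewrite andbT.
by apply: contraNneq vt => <-.
Qed.

(** The member [t] and its |X| - 3 distinct exchanges are all in [T]. *)
Lemma exchange_leq_card : T != set0 -> #|X| - 2 <= #|T|.
Proof.
case/set0Pn => t tT; have := subset_leq_card (h_sub tT).
have := cardsC t; rewrite (card_in_imset (h_inj tT)) (cardsD1 t T) tT (T3 tT).
have arith c d N : 3 + c = N -> c <= d -> N - 2 <= true + d by lia.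
exact: arith.
Qed.

(** In case of equality every other member is an exchange of any given one. Three members within
    four points, the alternative to a common pair, would give two exchanges of one member by the
    same point. *)
Lemma exchange_pencil : T != set0 -> #|T| = #|X| - 2 ->
  exists p q, p != q /\ T = pencil p q.
Proof.
move=> /set0Pn[t tT] cardT.
(* The injection [h t1] into [T :\ t1] is onto, the two sizes being equal. *)
have spread t1 t2 : t1 \in T -> t2 \in T -> t2 != t1 ->
    exists2 v, v \notin t1 & t2 = h t1 v.
  move=> t1T t2T t21.
  have E : h t1 @: (~: t1) = T :\ t1.
    apply/eqP; rewrite eqEcard h_sub // (card_in_imset (h_inj t1T)).
    have arith c d N : 3 + c = N -> N - 2 = true + d -> d <= c by lia.
    apply: (arith _ _ #|X|); first by rewrite -[RHS](cardsC t1) (T3 t1T).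
    by rewrite -cardT (cardsD1 t1 T) t1T.
  have : t2 \in T :\ t1 by rewrite !inE t21.
  by rewrite -E => /imsetP[v]; rewrite inE; exists v.
(* A common pair suffices: [T] then lies in a pencil of the same size. *)
suff [p [q [pq pqT]]] : exists p q, p != q /\
    forall t', t' \in T -> (p \in t') && (q \in t').
  exists p, q; split=> //; apply/eqP.
  rewrite eqEcard card_pencil // cardT leqnn andbT.
  by apply/subsetP=> t' t'T; rewrite inE T3 // pqT.
have [T1|[t1 t1T t1t]] : (forall t', t' \in T -> t' = t) \/
    (exists2 t1, t1 \in T & t1 != t).
  case: (boolP [exists t1 in T, t1 != t]) => [/exists_inP[t1 ? ?]|/exists_inPn no].
    by right; exists t1.
  by left=> t' /no; rewrite negbK => /eqP.
  have [/= p [q [pt qt pq]]] : exists p q, [/\ p \in t, q \in t & p != q].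
    by apply/card_gt1P; rewrite T3.
  by exists p, q; split=> // t' /T1->; rewrite pt.
have [v vt t1E] := spread _ _ tT t1T t1t.
have [_ vt1 t1v] := hP tT vt; rewrite -t1E in vt1 t1v.
have card_rem s u : s \in T -> u \in s -> #|s :\ u| = 2.
  by move=> sT us; have := cardsD1 u s; rewrite us T3 //; lia.
have : #|t1 :\ v| == 2 by rewrite card_rem.
(* The pair is what [t1] shares with [t]. *)
case/cards2P => p [q [pq t1pq]].
have rem_t : t1 :\ v \subset t by rewrite subDset.
exists p, q; split=> // t2 t2T.
suff : t1 :\ v \subset t2 by rewrite t1pq subUset !sub1set.
have [->//|t2t] := eqVneq t2 t; have [->|t21] := eqVneq t2 t1.
  by rewrite subD1set.
have [w wt t2E] := spread _ _ tT t2T t2t.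
have [_ wt2 t2w] := hP tT wt; rewrite -t2E in wt2 t2w.
have wv : w != v by apply: contra_neq t21 => wv; rewrite t2E t1E wv.
have wt1 : w \notin t1.
  by apply/negP => /(subsetP t1v); rewrite !inE (negPf wv) (negPf wt).
have vt2 : v \notin t2.
  by apply/negP => /(subsetP t2w); rewrite !inE eq_sym (negPf wv) (negPf vt).
have [u ut1 t2E1] := spread _ _ t1T t2T t21.
have [_ ut2 t2u] := hP t1T ut1; rewrite -t2E1 in ut2 t2u.
(* So [t2] is also the exchange of [t1] by w: its other two points lie in [t1] and differ from v,
   which leaves p and q. *)
have wu : w = u.
  by move: (subsetP t2u w wt2); rewrite !inE (negPf wt1) orbF => /eqP.
have /eqP <- : t2 :\ w == t1 :\ v; last exact: subD1set.
rewrite eqEcard !card_rem // andbT; apply/subsetP => x.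
rewrite !inE => /andP[xw xt2]; move: (subsetP t2u x xt2).
rewrite !inE -wu (negPf xw) /= => ->; rewrite andbT.
by apply: contraNneq vt2 => <-.
Qed.

End Exchange.

(** * The four-point condition on positions *)

Lemma between_withoutC a b i j k :
  between_without a b i j k = between_without a b k j i.
Proof.
rewrite /between_without /between orbC.
by rewrite -(rev_uniq [:: i; j; k]) -!(mem_rev [:: i; j; k]).
Qed.

Lemma between_without_sorted a b i j k : a < b -> i <= j -> j <= k ->
  between_without a b i j k = ~~ [&& i < j, j < k &
    [|| (a == i) && (b == j), (a == i) && (b == k) | (a == j) && (b == k)]].
Proof.
move=> ab ij jk; rewrite /between_without /between ij jk /= !inE negb_or.
have [->|nij] := eqVneq i j; first by rewrite ltnn.
have [->|njk] := eqVneq j k; first by rewrite ltnn !andbF.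
have lij : i < j by lia.
have ljk : j < k by lia.
have -> : i != k by lia.
rewrite lij ljk /=; congr (~~ _).
have [ai|ai] := eqVneq a i; have [aj|aj] := eqVneq a j;
  have [ak|ak] := eqVneq a k; rewrite /= ?orbF; lia.
Qed.

(** For a < b < c < d, the triples abc and acd cover every pair except bd, while abd and bcd cover
    every pair except ac. The sides can differ only if {p, q} is one of these two pairs, that is,
    with a point between p and q and another outside, which the positions of p and q exclude. *)
Lemma between_without_quad n p q a b c d : p < q < n ->
    q = p.+1 \/ (p = 0 /\ q = n.-1) ->
    a <= b -> b <= c -> c <= d -> d < n ->
  between_without p q a b c && between_without p q a c d =
  between_without p q a b d && between_without p q b c d.
Proof.
move=> /andP[pq qn] pq_pos ab bc cd dn.
have ac := leq_trans ab bc; have bd := leq_trans bc cd.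
rewrite !between_without_sorted //.
have [->|nab] := eqVneq a b; first by rewrite ltnn /= andbC.
have [->|nbc] := eqVneq b c; first by rewrite ltnn /= !andbF !andbT.
have [->|ncd] := eqVneq c d; first by rewrite ltnn /= !andbF !andbT.
have lab : a < b by rewrite ltn_neqAle nab.
have lbc : b < c by rewrite ltn_neqAle nbc.
have lcd : c < d by rewrite ltn_neqAle ncd.
rewrite lab lbc lcd (ltn_trans lab lbc) (ltn_trans lbc lcd) /=.
have [pa|pa] := eqVneq p a; have [pb|pb] := eqVneq p b;
  have [pc|pc] := eqVneq p c; rewrite /= ?orbF; lia.
Qed.

Lemma between_without_trans n p q i j k l : p < q < n ->
    q = p.+1 \/ (p = 0 /\ q = n.-1) ->
    i < n -> k < n ->
    between_without p q i j k -> between_without p q i l j ->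
  between_without p q i l k /\ between_without p q l j k.
Proof.
move=> pq_lt pq i_n k_n ijk ilj.
have /andP[/orP ijk_le _] := ijk; have /andP[/orP ilj_le _] := ilj.
apply/andP; case: ijk_le => /andP[le1 le2].
  have /andP[il lj] : i <= l <= j by case: ilj_le => /andP[] *; apply/andP; lia.
  by rewrite -(between_without_quad pq_lt pq il lj le2 k_n) ilj.
(* The descending case: the four-point identity is applied to k, j, l, i and the triples are
   reversed. *)
have /andP[jl li] : j <= l <= i by case: ilj_le => /andP[] *; apply/andP; lia.
rewrite ![between_without _ _ _ _ k]between_withoutC andbC.
rewrite (between_without_quad pq_lt pq le1 jl li i_n).
by rewrite -between_withoutC ijk -between_withoutC.
Qed.

(** * Structures read through a position function *)

Section Line.
Variables (X : finType) (f : X -> nat).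
Hypotheses (f_inj : injective f) (f_lt : forall x, f x < #|X|).

Lemma line_surj k : k < #|X| -> exists x, f x = k.
Proof.
move=> k_lt; pose g x := Ordinal (f_lt x).
have g_inj : injective g by move=> x y [] /f_inj.
have [|h gh hg] := @inj_card_bij _ _ g g_inj; first by rewrite card_ord.
by exists (h (Ordinal k_lt)); rewrite -[LHS]/(val (g _)) hg.
Qed.

(** The required path lists the points by position, through the inverse of [f]. *)
Lemma ordered_line (R : realType) : ordered R (line f).
Proof.
pose g x := Ordinal (f_lt x).
have g_inj : injective g by move=> x y [] /f_inj.
have [|h gh hg] := @inj_card_bij _ _ g g_inj; first by rewrite card_ord.
have h_inj := can_inj hg.
pose s := map h (enum 'I_#|X|).
have Us : uniq s by rewrite map_inj_uniq ?enum_uniq.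
have sT x : x \in s by rewrite -[x]gh mem_map ?mem_enum.
exists s; split=> //; rewrite induced_path //.
have fE x : index x s = f x.
  by rewrite -[x in index x]gh index_map // index_enum_ord.
by apply/setP=> t; rewrite !inE !fE.
Qed.

Lemma card3_sorted (T : {set X}) : #|T| = 3 ->
  exists x y z, [/\ f x < f y, f y < f z & T = [set x; y; z]].
Proof.
move=> T3; pose s := sort (relpre f leq) (enum T).
have : sorted (relpre f leq) s by apply: sort_sorted => x y; exact: leq_total.
have : uniq s by rewrite sort_uniq enum_uniq.
have : size s = 3 by rewrite size_sort -cardE.
have : T =i s by move=> x; rewrite mem_sort mem_enum.
case: s => [|x [|y [|z []]]] //= Ts _ U /and3P[xy yz _].
have lt u v : f u <= f v -> u != v -> f u < f v.
  by move=> le uv; rewrite ltn_neqAle le andbT (inj_eq f_inj).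
move: U; rewrite !inE negb_or => /and3P[/andP[nxy _] nyz _].
exists x, y, z; split; [exact: lt | exact: lt |].
by apply/setP=> u; rewrite Ts !inE orbA.
Qed.

Lemma card_sorted3 x y z : f x < f y -> f y < f z -> #|[set x; y; z]| = 3.
Proof.
move=> xy yz; have ne u v : f u < f v -> u != v.
  by move=> uv; apply: contraTneq uv => ->; rewrite ltnn.
rewrite -setUA cardsU1 cards2 !inE negb_or.
by rewrite !ne // (ltn_trans xy).
Qed.

Section Substructure.
Variable B : {set X * X * X}.
Hypotheses (B_sub : B \subset line f)
  (B_sym : forall x y z, (x, y, z) \in B -> (z, y, x) \in B).

Lemma mem_between x y z : (x, y, z) \in B -> between (f x) (f y) (f z).
Proof. by move/(subsetP B_sub); rewrite inE. Qed.

(** Of all orderings of three points, only the increasing one and its reversal fit into [line f]. *)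
Lemma collinear_sorted x y z : f x < f y -> f y < f z ->
  collinear B [set x; y; z] = ((x, y, z) \in B).
Proof.
move=> xy yz; have xz := ltn_trans xy yz.
have ne u v : f u < f v -> (u == v) = false.
  by move=> uv; apply/eqP => E; rewrite E ltnn in uv.
apply/idP/idP => [|xyz]; last first.
  apply/exists_inP; exists x; first by rewrite !inE eqxx.
  apply/exists_inP; exists y; first by rewrite !inE eqxx orbT.
  apply/exists_inP; exists z; first by rewrite !inE eqxx orbT.
  by rewrite /= !inE !ne.
case/exists_inP => a aT /exists_inP[b bT] /exists_inP[c cT] /andP[U abc].
have := mem_between abc; move: abc U.
move: aT bT cT;
  rewrite !inE -!orbA => /or3P[]/eqP-> /or3P[]/eqP-> /or3P[]/eqP->;
  rewrite /= ?inE ?eqxx ?orbT ?andbF //= /between; try by move=> *; lia.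
by move/B_sym.
Qed.

Lemma triangle_sorted x y z : f x < f y -> f y < f z ->
  ([set x; y; z] \in triangles B) = ((x, y, z) \notin B).
Proof. by move=> xy yz; rewrite inE card_sorted3 // collinear_sorted. Qed.

End Substructure.

Lemma line_without_refl x z a b : (x, x, z) \in line_without f a b.
Proof. by rewrite !inE /between_without /between /= !inE eqxx /=; lia. Qed.

Lemma triangles_line_without p q : p != q ->
  triangles (line_without f (f p) (f q)) = pencil p q.
Proof.
move=> pq.
have sub : line_without f (f p) (f q) \subset line f.
  by apply/subsetP=> t; rewrite !inE => /andP[].
have sym x y z : (x, y, z) \in line_without f (f p) (f q) ->
    (z, y, x) \in line_without f (f p) (f q).
  by rewrite !inE between_withoutC.
apply/setP=> T; case: (eqVneq #|T| 3) => [T3|nT3]; last first.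
  by rewrite !inE (negPf nT3).
have [x [y [z [xy yz TE]]]] := card3_sorted T3.
rewrite TE (triangle_sorted sub sym) // [in RHS]inE card_sorted3 //.
rewrite !inE /between_without /between /=.
rewrite !inE !(inj_eq f_inj) !(ltnW xy) !(ltnW yz) /= negbK.
have ne u v : f u < f v -> (u == v) = false.
  by move=> uv; apply/eqP => E; rewrite E ltnn in uv.
by rewrite (ne x y) // (ne y z) // (ne x z) ?(ltn_trans xy) //= -!orbA.
Qed.

(** The positions of [a] and [b] matter for P4, which is the four-point condition. *)
Lemma line_without_almost_metrizable a b : a < b < #|X| ->
    b = a.+1 \/ (a = 0 /\ b = #|X|.-1) ->
  almost_metrizable (line_without f a b).
Proof.
move=> ab_lt ab; split.
- by move=> x z; exact: line_without_refl.
- by move=> x y z; rewrite !inE between_withoutC.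
- move=> x y z;
  rewrite !inE /between_without /between /= => /andP[xyz _] /andP[yxz _].
  by apply: f_inj; lia.
- move=> x y z w; rewrite !inE.
  exact: (between_without_trans ab_lt ab (f_lt x) (f_lt z)).
Qed.

End Line.

(** * Orderable structures of minimum co-size *)

Section Minimal.
Variables (X : finType) (f : X -> nat) (B : {set X * X * X}).
Hypotheses (f_inj : injective f) (f_lt : forall x, f x < #|X|).
Hypotheses (B_am : almost_metrizable B) (B_sub : B \subset line f).

Let B_sym x y z : (x, y, z) \in B -> (z, y, x) \in B.
Proof. by case: B_am => _ + _ _; apply. Qed.

Let quad x y z w : (x, y, z) \in B -> (x, w, y) \in B ->
  (x, w, z) \in B /\ (w, y, z) \in B.
Proof. by case: B_am => _ _ _; apply. Qed.

(** If the three other triples in v + t were all collinear, P4 would make t collinear as well. *)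
Lemma triangle_exchange t v : t \in triangles B -> v \notin t ->
  exists2 t', t' \in triangles B & (v \in t') && (t' \subset v |: t).
Proof.
move=> tB vt; apply: contrapT => no.
have K x y z : f x < f y -> f y < f z -> v \in [set x; y; z] ->
    [set x; y; z] \subset v |: t -> (x, y, z) \in B.
  move=> xy yz vxyz xyzt; apply: contrapT => /negP xyzB; apply: no.
  exists [set x; y; z]; last by rewrite vxyz.
  by rewrite (triangle_sorted B_sub B_sym).
have t3 : #|t| = 3 by move: tB; rewrite inE => /andP[/eqP].
have [x [y [z [xy yz tE]]]] := card3_sorted f_inj t3; subst t.
move: tB; rewrite (triangle_sorted B_sub B_sym) // => /negP; apply.
have sub a b c : a \in [set v; x; y; z] -> b \in [set v; x; y; z] ->
    c \in [set v; x; y; z] -> [set a; b; c] \subset v |: [set x; y; z].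
  by rewrite !setUA => aS bS cS; rewrite !subUset !sub1set aS bS cS.
have K' a b c : f a < f b -> f b < f c -> v \in [set a; b; c] ->
    a \in [set v; x; y; z] -> b \in [set v; x; y; z] ->
    c \in [set v; x; y; z] -> (a, b, c) \in B.
  by move=> *; apply: K => //; exact: sub.
have ne u : u \in [set x; y; z] -> f u <> f v.
  by move=> uS /f_inj uv; rewrite -uv uS in vt.
have nx : f x <> f v by apply: ne; rewrite !inE eqxx.
have ny : f y <> f v by apply: ne; rewrite !inE eqxx orbT.
have nz : f z <> f v by apply: ne; rewrite !inE eqxx orbT.
(* In each of the four places of v among x, y, z, two triples through v yield xyz by P4, read
   backwards in the second and fourth. *)
have [vx|xv] := ltnP (f v) (f x).
  have vxy : (v, x, y) \in B by apply: K'; rewrite ?inE ?eqxx ?orbT.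
  have vyz : (v, y, z) \in B by apply: K'; rewrite ?inE ?eqxx ?orbT //; lia.
  by have [] := quad vyz vxy.
have [vy|yv] := ltnP (f v) (f y).
  have xvz : (x, v, z) \in B by apply: K'; rewrite ?inE ?eqxx ?orbT //; lia.
  have vyz : (v, y, z) \in B by apply: K'; rewrite ?inE ?eqxx ?orbT.
  by apply: B_sym; have [] := quad (B_sym xvz) (B_sym vyz).
have [vz|zv] := ltnP (f v) (f z).
  have xyv : (x, y, v) \in B by apply: K'; rewrite ?inE ?eqxx ?orbT //; lia.
  have xvz : (x, v, z) \in B by apply: K'; rewrite ?inE ?eqxx ?orbT //; lia.
  by have [] := quad xvz xyv.
have xyv : (x, y, v) \in B by apply: K'; rewrite ?inE ?eqxx ?orbT //; lia.
have yzv : (y, z, v) \in B by apply: K'; rewrite ?inE ?eqxx ?orbT //; lia.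
by apply: B_sym; have [] := quad (B_sym xyv) (B_sym yzv).
Qed.

Let card_triangle t : t \in triangles B -> #|t| = 3.
Proof. by rewrite inE => /andP[/eqP]. Qed.

Lemma cosize_geq : 0 < cosize B -> #|X| - 2 <= cosize B.
Proof.
rewrite /cosize card_gt0.
exact: (exchange_leq_card card_triangle triangle_exchange).
Qed.

Lemma pencil_notin p q x y z : triangles B = pencil p q ->
  f x < f y -> f y < f z ->
  ((x, y, z) \in B) = ~~ ((p \in [:: x; y; z]) && (q \in [:: x; y; z])).
Proof.
move=> BE xy yz; rewrite -[LHS]negbK -(triangle_sorted B_sub B_sym) // BE inE.
by rewrite (card_sorted3 xy yz) !inE -!orbA.
Qed.

(** If p and q are not consecutive, some u lies between them and puq is a triangle; P4 then forbids
    points on either side, so p and q are the ends. *)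
Lemma pencil_position p q : triangles B = pencil p q -> f p < f q ->
  f q = (f p).+1 \/ (f p = 0 /\ f q = #|X|.-1).
Proof.
move=> BE pq; have [|ne] := eqVneq (f q) (f p).+1; first by left.
right; have [|u uE] := @line_surj _ _ f_inj f_lt (f p).+1.
  by have := f_lt q; lia.
have pu : f p < f u by lia.
have uq : f u < f q by lia.
have ne_lt v w : f v < f w -> (v == w) = false.
  by move=> vw; apply/eqP => E; rewrite E ltnn in vw.
have ne_gt v w : f v < f w -> (w == v) = false.
  by move=> vw; rewrite eq_sym ne_lt.
have puqB : (p, u, q) \notin B by rewrite (pencil_notin BE) // !inE !eqxx !orbT.
(* Neither wpu nor wuq contains both p and q, so both are collinear and P4 would give puq. The right
   side is the mirror image. *)
have noL w : ~ f w < f p.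
  move=> wp; have wu := ltn_trans wp pu; have wq := ltn_trans wu uq.
  have wpu : (w, p, u) \in B.
    by rewrite (pencil_notin BE) // !inE (ne_gt w q) //
      (ne_gt p q) // (ne_gt u q) // andbF.
  have wuq : (w, u, q) \in B.
    by rewrite (pencil_notin BE) // !inE (ne_gt w p) //
      (ne_lt p u) // (ne_lt p q).
  by have [_] := quad wuq wpu; apply/negP.
have noR w : ~ f q < f w.
  move=> qw; have uw := ltn_trans uq qw; have pw := ltn_trans pu uw.
  have puw : (p, u, w) \in B.
    by rewrite (pencil_notin BE) // !inE (ne_gt p q) //
      (ne_gt u q) // (ne_lt q w) // andbF.
  have uqw : (u, q, w) \in B.
    by rewrite (pencil_notin BE) // !inE (ne_lt p u) //
      (ne_lt p q) // (ne_lt p w).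
  by have [_ /B_sym] := quad (B_sym puw) (B_sym uqw); apply/negP.
split.
  have [|w w0] := @line_surj _ _ f_inj f_lt 0; first by have := f_lt p; lia.
  by have := noL w; lia.
have [|w w0] := @line_surj _ _ f_inj f_lt #|X|.-1; first by have := f_lt p; lia.
by have := noR w; have := f_lt q; lia.
Qed.

(** The triangles decide the increasing triples, symmetry the decreasing ones, P1 and P2 the
    degenerate ones; all other triples are outside [line f]. *)
Lemma pencil_line_without p q :
  triangles B = pencil p q -> B = line_without f (f p) (f q).
Proof.
move=> BE.
have sorted_eq x y z : f x < f y -> f y < f z ->
    ((x, y, z) \in B) = ((x, y, z) \in line_without f (f p) (f q)).
  move=> xy yz; rewrite (pencil_notin BE) // !inE /between_without /between /=.
  rewrite !inE !(inj_eq f_inj) !(ltnW xy) !(ltnW yz) /=.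
  rewrite -(inj_eq f_inj x y) -(inj_eq f_inj x z) -(inj_eq f_inj y z).
  by rewrite !ltn_eqF // (ltn_trans xy).
apply/setP=> -[[x y] z].
have [xyz|nxyz] := boolP (between (f x) (f y) (f z)); last first.
  rewrite inE /between_without (negPf nxyz) /=.
  by apply: contraNF nxyz; exact: mem_between.
have [P1 _ _ _] := B_am.
have [xy|xy] := eqVneq x y; first by rewrite xy P1 line_without_refl.
have sym (C : {set X * X * X}) a b c :
    (forall u v w, (u, v, w) \in C -> (w, v, u) \in C) ->
    ((a, b, c) \in C) = ((c, b, a) \in C).
  by move=> C_sym; apply/idP/idP; apply: C_sym.
have LS u v w : (u, v, w) \in line_without f (f p) (f q) ->
    (w, v, u) \in line_without f (f p) (f q).
  by rewrite !inE between_withoutC.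
have [yz|yz] := eqVneq y z.
  by rewrite yz [LHS]sym // P1 [RHS]sym // line_without_refl.
rewrite -(inj_eq f_inj) in xy; rewrite -(inj_eq f_inj) in yz.
have [lt|gt] := ltnP (f x) (f y).
  by apply: sorted_eq => //; move: xyz; rewrite /between; lia.
rewrite [LHS]sym // [RHS]sym //.
by apply: sorted_eq => //; move: xyz; rewrite /between; lia.
Qed.

End Minimal.

Lemma minimal_line (R : realType) (X : finType) (B : {set X * X * X}) :
    almost_metrizable B -> orderable R B -> 0 < cosize B ->
  #|X| - 2 <= cosize B /\
  (cosize B = #|X| - 2 -> exists f : X -> nat, exists p q,
     [/\ injective f, (forall x, f x < #|X|), p < q < #|X|,
         (q = p.+1 \/ (p = 0 /\ q = #|X|.-1)) & B = line_without f p q]).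
Proof.
move=> Bam [C [s [Us sT CE]] BC] B0; pose f x := index x s.
rewrite induced_path // in CE; rewrite CE in BC.
have f_inj : injective f.
  by move=> x y E; rewrite -(nth_index x (sT x)) -/(f x) E nth_index.
have f_lt x : f x < #|X|.
  have -> : #|X| = size s by rewrite -(card_uniqP Us); apply: eq_card => y;
    rewrite sT.
  by rewrite index_mem.
split; first exact: (cosize_geq f_inj Bam BC).
move=> cB;
  have T3 t : t \in triangles B -> #|t| = 3 by rewrite inE => /andP[/eqP].
have [|p [q [pq BE]]] :=
    exchange_pencil T3 (triangle_exchange f_inj Bam BC) _ cB.
  by rewrite -card_gt0.
(* A pencil is symmetric in its two points. *)
wlog lt_pq : p q pq BE / f p < f q.
  move=> main; have [lt|ge] := ltnP (f p) (f q); first exact: (main p q).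
  apply: (main q p); first by rewrite eq_sym.
    by rewrite BE; apply/setP=> t; rewrite !inE [_ && (q \in t)]andbC.
  by rewrite ltn_neqAle ge (inj_eq f_inj) eq_sym pq.
exists f, (f p), (f q); split=> //; first by rewrite lt_pq f_lt.
  exact: (pencil_position f_inj f_lt Bam BC).
exact: (pencil_line_without f_inj Bam BC).
Qed.

(** * Classification up to isomorphism *)

Lemma line_without_in_B (R : realType) (X : finType) (f : X -> nat) p q :
    injective f -> (forall x, f x < #|X|) -> p < q < #|X| ->
    q = p.+1 \/ (p = 0 /\ q = #|X|.-1) ->
  in_B (@orderable R) #|X| (#|X| - 2) (line_without f p q).
Proof.
move=> f_inj f_lt pq_lt pq; split=> //.
- split; first by lia.
  exact: (line_without_almost_metrizable f_inj f_lt pq_lt pq).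
- have [|x xE] := @line_surj _ _ f_inj f_lt p; first by lia.
  have [|y yE] := @line_surj _ _ f_inj f_lt q; first by lia.
  have xy : x != y by apply/eqP => E; move: pq_lt; rewrite -xE -yE E ltnn.
  by rewrite /cosize -xE -yE triangles_line_without ?card_pencil.
- exists (line f); first exact: ordered_line.
  by apply/subsetP=> t; rewrite !inE => /andP[].
Qed.

(** Matching points of equal position preserves everything, as the structure depends on positions
    alone. *)
Lemma line_without_isomorphic (X Y : finType) (f : X -> nat) (g : Y -> nat)
    a b :
    injective f -> (forall x, f x < #|X|) ->
    injective g -> (forall y, g y < #|Y|) -> #|X| = #|Y| ->
  isomorphic (line_without f a b) (line_without g a b).
Proof.
move=> f_inj f_lt g_inj g_lt XY.
have gf x : exists y, g y == f x.
  have [|y yE] := @line_surj _ _ g_inj g_lt (f x); first by rewrite -XY.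
  by exists y; rewrite yE.
pose h x := xchoose (gf x).
have hE x : g (h x) = f x by apply/eqP; exact: xchooseP (gf x).
exists h; last by move=> x y z; rewrite !inE /= !hE.
by apply: inj_card_bij; [move=> x y E; apply: f_inj;
  rewrite -!hE E | rewrite XY].
Qed.

Lemma isomorphic_line_without (X Y : finType) (B : {set X * X * X})
    (g : Y -> nat) a b : isomorphic B (line_without g a b) ->
  exists h : X -> Y, bijective h /\ B = line_without (g \o h) a b.
Proof.
case=> h h_bij BE; exists h; split=> //.
by apply/setP=> -[[x y] z]; rewrite BE !inE.
Qed.

Lemma isomorphic_line_without_in_B (R : realType) (X Y : finType)
    (B : {set X * X * X}) (g : Y -> nat) p q :
    injective g -> (forall y, g y < #|Y|) -> p < q < #|Y| ->
    q = p.+1 \/ (p = 0 /\ q = #|Y|.-1) -> isomorphic B (line_without g p q) ->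
  in_B (@orderable R) #|Y| (#|Y| - 2) B.
Proof.
move=> g_inj g_lt pq_lt pq /isomorphic_line_without[h [h_bij ->]].
have XY := bij_eq_card h_bij; rewrite -XY in g_lt pq_lt pq *.
apply: line_without_in_B => //; last by move=> x; exact: g_lt.
exact: inj_comp g_inj (bij_inj h_bij).
Qed.

(** Reading the ordering backwards brings a consecutive pair into the left half, which is why the
    index i of R stops near the middle. *)
Lemma line_without_reflect (X : finType) (f : X -> nat) n a b :
    (forall x, f x < n) -> a < n -> b < n ->
  line_without f a b = line_without (fun x => n.-1 - f x) (n.-1 - b) (n.-1 - a).
Proof.
move=> f_lt an bn; apply/setP=> -[[x y] z].
pose r i := n.-1 - i.
have r_eq i j : i < n -> j < n -> (r i == r j) = (i == j) by rewrite /r; lia.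
have r_between i j k : i < n -> j < n -> k < n ->
    between (r i) (r j) (r k) = between i j k by rewrite /r /between; lia.
rewrite !inE /between_without /= !inE r_between // !r_eq //.
by congr (_ && ~~ (_ && _)); rewrite andbC.
Qed.

Lemma card_vertex n : 3 <= n -> #|vertex n| = n.
Proof. by move=> n3; rewrite card_sum card_ord card_bool; lia. Qed.

Lemma pos_split_inj n i : injective (@pos_split n i).
Proof.
case=> [j|[]] [k|[]] //=; do ?case: ifP; rewrite ?addn0 ?addn1; try lia.
all: by move=> *; congr inl; apply: val_inj => /=; lia.
Qed.

Lemma pos_split_lt n i (v : vertex n) :
  3 <= n -> i <= n - 2 -> pos_split i v < n.
Proof. by case: v => [[j ?]|[]] /=; do ?case: ifP; lia. Qed.

Lemma pos_ends_inj n : 3 <= n -> injective (@pos_ends n).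
Proof.
move=> n3; case=> [[j ?]|[]] [[k ?]|[]] //=; try lia.
by move=> [jk]; congr inl; apply: val_inj.
Qed.

Lemma pos_ends_lt n (v : vertex n) : 3 <= n -> pos_ends v < n.
Proof. by case: v => [[j ?]|[]] /=; lia. Qed.

(** The number p of points before the consecutive pair is the index: p = 0 gives Q and p > 0 gives R
    with i = p. *)
Lemma adjacent_isomorphic (R : realType) n (X : finType) (f : X -> nat) p :
    3 <= n -> #|X| = n -> injective f -> (forall x, f x < n) ->
    p <= uphalf (n - 3) ->
  isomorphic (line_without f p p.+1) (induced (Q2 R n)) \/
  4 <= n /\ exists2 i, I2 n i &
    isomorphic (line_without f p p.+1) (induced (R2 R n i)).
Proof.
move=> n3 Xn f_inj f_lt p_le; have cV := card_vertex n3.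
have iso : isomorphic (line_without f p p.+1)
    (line_without (@pos_split n p) p p.+1).
  apply: line_without_isomorphic; rewrite ?cV ?Xn //;
    first exact: pos_split_inj.
  by move=> v; apply: pos_split_lt => //; lia.
have [p0|p_gt0] := posnP p; first by left; rewrite induced_Q2 // -p0.
have n4 : 4 <= n by lia.
by right; split=> //; exists p; rewrite ?induced_R2 // /I2 p_gt0.
Qed.

Lemma in_B_isomorphic (R : realType) n (X : finType) (B : {set X * X * X}) :
    3 <= n -> in_B (@orderable R) n (n - 2) B ->
  [\/ isomorphic B (induced (Q2 R n)),
      4 <= n /\ (exists2 i : nat, I2 n i & isomorphic B (induced (R2 R n i)))
    | isomorphic B (induced (S2 R n))].
Proof.
move=> n3 [[_ Bam] Xn cB Bord].
have [|_] := minimal_line Bam Bord; first by rewrite cB; lia.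
rewrite Xn => /(_ cB)[f [p [q [f_inj f_lt pq_lt pq ->]]]].
case: pq => [qE|[p0 qE]]; last first.
  apply: Or33; rewrite induced_S2 // p0 qE.
  apply: line_without_isomorphic; rewrite ?Xn ?card_vertex //.
    exact: pos_ends_inj.
  by move=> v; exact: pos_ends_lt.
rewrite {q}qE in pq_lt *.
suff [?|?] : isomorphic (line_without f p p.+1) (induced (Q2 R n)) \/
  4 <= n /\ exists2 i, I2 n i &
    isomorphic (line_without f p p.+1) (induced (R2 R n i)).
- exact: Or31.
- exact: Or32.
(* After reflection the pair starts at n - 2 - p, which is within the bound once p exceeds it. *)
have [p_le|p_gt] := leqP p (uphalf (n - 3)); first exact: adjacent_isomorphic.
rewrite (line_without_reflect f_lt); try lia.
have -> : n.-1 - p = (n.-1 - p.+1).+1 by lia.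
apply: adjacent_isomorphic => //; last by lia.
- by move=> x y E; apply: f_inj; have := f_lt x; have := f_lt y; lia.
- by move=> x; lia.
Qed.

Lemma isomorphic_in_B (R : realType) n (X : finType) (B : {set X * X * X}) :
    3 <= n ->
  [\/ isomorphic B (induced (Q2 R n)),
      4 <= n /\ (exists2 i : nat, I2 n i & isomorphic B (induced (R2 R n i)))
    | isomorphic B (induced (S2 R n))] ->
  in_B (@orderable R) n (n - 2) B.
Proof.
move=> n3; have cV := card_vertex n3.
have inB (g : vertex n -> nat) p q : injective g -> (forall v, g v < n) ->
    p < q < n -> q = p.+1 \/ (p = 0 /\ q = n.-1) ->
    isomorphic B (line_without g p q) -> in_B (@orderable R) n (n - 2) B.
  move=> g_inj; move: (@isomorphic_line_without_in_B R X _ B g p q g_inj).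
  by rewrite cV; apply.
case=> [|[n4 [i iI]]|].
- rewrite induced_Q2 //; apply: inB; [exact: pos_split_inj | | lia | by left].
  by move=> v; exact: pos_split_lt.
- rewrite induced_R2 //; case/andP: iI => i1 iu.
  apply: inB; [exact: pos_split_inj | | lia | by left].
  by move=> v; apply: pos_split_lt => //; lia.
- rewrite induced_S2 //; apply: inB; [exact: pos_ends_inj | | lia | by right].
  by move=> v; exact: pos_ends_lt.
Qed.

Theorem theorem3 (R : realType) (n : nat) (hn : (3 <= n)%N) :
  tau (@orderable R) n 0 = (n - 2)%N /\
  forall (X : finType) (B : {set X * X * X}),
    in_B (@orderable R) n (tau (@orderable R) n 0) B <->
    [\/ isomorphic B (induced (Q2 R n)),
        (4 <= n)%N /\ (exists2 i : nat, I2 n i & isomorphic B (induced (R2 R n i)))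
      | isomorphic B (induced (S2 R n))].
Proof.
have tauE : tau (@orderable R) n 0 = n - 2.
  (* Q attains n - 2, so the minimum is over a nonempty set and [tau] does not take its default
     0. *)
  have BQ : B_nonempty (@orderable R) n (n - 2).
    exists (vertex n), (induced (Q2 R n)); apply: isomorphic_in_B => //.
    by apply: Or31; exists id => //; exists id.
  rewrite /tau; case: pselect => [h|[]]; last first.
    by exists (n - 2); apply/andP; split; [lia | apply/asboolP].
  case: ex_minnP => m /andP[m0 /asboolP[X [B [[_ Bam] Xn cB Bord]]]] m_min.
  apply/eqP; rewrite eqn_leq m_min; last first.
    by apply/andP; split; [lia | apply/asboolP].
  by rewrite -cB in m0 *; have [] := minimal_line Bam Bord m0; rewrite Xn.
split=> // X B; rewrite tauE; split; first exact: in_B_isomorphic.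
exact: isomorphic_in_B.
Qed.
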